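(* (a) Let $(B,\nu)$ be a finite-dimensional Zinbiel coalgebra and $(D=\oplus_{i\in\mathbb Z}D_i,\theta_\dashv,\theta_\vdash)$ a completed diassociative coalgebra. Define $\Delta:D\otimes B\to(D\otimes B)\,\hat\otimes\,(D\otimes B)$ by $$\Delta(d\otimes b)=\theta_\vdash(d)\bullet\nu(b)+\theta_\dashv(d)\bullet\tau(\nu(b)).$$ Then $(D\otimes B,\Delta)$ is a completed coassociative coalgebra. (b) Let $D=\{f_1\partial_1+f_2\partial_2\mid f_1,f_2\in\Bbbk[t,t^{-1}]\}$, graded by $D_i=\mathrm{span}\{t^{i-1}\partial_1,t^i\partial_2\}$, be the completed diassociative coalgebra with, for $i\in\mathbb Z$, $$\theta_\dashv(t^i\partial_1)=\sum_{j\in\mathbb Z}\big(t^{-j}\partial_1\otimes t^{i+j}\partial_1-t^{-j}\partial_1\otimes t^{i+j+1}\partial_2\big),\quad\theta_\dashv(t^i\partial_2)=\sum_{j\in\mathbb Z}\big(t^{-j}\partial_2\otimes t^{i+j}\partial_1-t^{-j}\partial_2\otimes t^{i+j+1}\partial_2\big),$$ $$\theta_\vdash(t^i\partial_1)=\sum_{j\in\mathbb Z}\big(t^{-j}\partial_1\otimes t^{i+j}\partial_1-t^{-j}\partial_2\otimes t^{i+j+1}\partial_1\big),\quad\theta_\vdash(t^i\partial_2)=\sum_{j\in\mathbb Z}\big(t^{-j}\partial_1\otimes t^{i+j}\partial_2-t^{-j}\partial_2\otimes t^{i+j+1}\partial_2\big).$$ Let $B$ be a finite-dimensional vector space with a linear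 map $\nu:B\to B\otimes B$, and define $\Delta$ by the formula in (a). Then $(D\otimes B,\Delta)$ is a completed coassociative coalgebra if and only if $(B,\nu)$ is a Zinbiel coalgebra.
   Context: $\Bbbk$ is a field of characteristic zero; $\tau(x\otimes y)=y\otimes x$; $(d'\otimes d'')\bullet(b'\otimes b''):=(d'\otimes b')\otimes(d''\otimes b'')$, extended to formal infinite sums. A Zinbiel coalgebra $(B,\nu)$ satisfies $(\mathrm{id}\otimes\nu)\nu=(\nu\otimes\mathrm{id})\nu+(\tau\otimes\mathrm{id})(\nu\otimes\mathrm{id})\nu$. For $\mathbb Z$-graded spaces $U=\oplus U_i$, $V=\oplus V_j$ the completed tensor product is $U\,\hat\otimes\,V=\prod_{i,j}U_i\otimes V_j$ (similarly for three factors); maps such as $\theta\,\hat\otimes\,\mathrm{id}$ act termwise on formal sums, and all iterated composites appearing below are assumed well defined (in each multidegree only finitely many nonzero contributions). $D\otimes B$ is graded by $D_i\otimes B$. A completed coassociative coalgebra $(A=\oplus A_i,\Delta)$ is a $\mathbb Z$-graded space with linear $\Delta:A\to A\,\hat\otimes\,A$ satisfying $(\Delta\,\hat\otimes\,\mathrm{id})\Delta=(\mathrm{id}\,\hat\otimes\,\Delta)\Delta$. A completed diassociative coalgebra $(D,\theta_\dashv,\theta_\vdash)$ is a $\mathbb Z$-graded space with two linear maps $\theta_\dashv,\theta_\vdash:D\to D\,\hat\otimes\,D$, each coassociative in this sense, with $(\theta_\dashv\,\hat\otimes\,\mathrm{id})\theta_\dashv=(\mathrm{id}\,\hat\otimes\,\theta_\vdash)\theta_\dashv$,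 $(\theta_\vdash\,\hat\otimes\,\mathrm{id})\theta_\dashv=(\mathrm{id}\,\hat\otimes\,\theta_\dashv)\theta_\vdash$, $(\theta_\dashv\,\hat\otimes\,\mathrm{id})\theta_\vdash=(\theta_\vdash\,\hat\otimes\,\mathrm{id})\theta_\vdash$. *)

(* Defs.v *)
From HB Require Import structures.
From mathcomp Require Import all_boot all_algebra.
From mathcomp Require Import finmap boolp classical_sets cardinality fsbigop.
From mathcomp.multinomials Require Import monalg.

Set Implicit Arguments.
Unset Strict Implicit.
Unset Printing Implicit Defensive.

Import GRing.Theory.
Local Open Scope classical_set_scope.
Local Open Scope quotient_scope.
Local Open Scope ring_scope.

(* The tensor product of two (possibly infinite-dimensional) vector spaces:
   a list [:: (u_1, v_1); ...; (u_n, v_n)] stands for the formal sum of the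
   u_k ⊗ v_k, and [tens_rel] is the congruence generated by commutativity,
   biadditivity and balancedness. *)
Section Tensor.
Context {K : fieldType}.

Inductive tens_rel (U V : lmodType K) : seq (U * V) -> seq (U * V) -> Prop :=
| TensRefl s : tens_rel s s
| TensSym s t : tens_rel s t -> tens_rel t s
| TensTrans s t r : tens_rel s t -> tens_rel t r -> tens_rel s r
| TensCat s s' t t' :
    tens_rel s s' -> tens_rel t t' -> tens_rel (s ++ t) (s' ++ t')
| TensComm s t : tens_rel (s ++ t) (t ++ s)
| TensZero v : tens_rel [:: (0, v)] [::]
| TensAddL u u' v : tens_rel [:: (u + u', v)] [:: (u, v); (u', v)]
| TensAddR u v v' : tens_rel [:: (u, v + v')] [:: (u, v); (u, v')]
| TensScale a u v : tens_rel [:: (a *: u, v)] [:: (u, a *: v)].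

Definition tens_relb (U V : lmodType K) : rel (seq (U * V)) :=
  fun s t => `[< tens_rel s t >].

Lemma tens_relb_class (U V : lmodType K) : equiv_class_of (@tens_relb U V).
Proof.
split=> [s|s t|t s r].
- by apply/asboolP; exact: TensRefl.
- by apply/asboolP/asboolP; exact: TensSym.
- by move=> /asboolP st /asboolP tr; apply/asboolP; exact: TensTrans tr.
Qed.

Canonical tens_equiv (U V : lmodType K) := EquivRelPack (@tens_relb_class U V).

Definition tensor (U V : lmodType K) := {eq_quot @tens_equiv U V}.

Section Structure.
Variables U V : lmodType K.
Implicit Types (s t : seq (U * V)) (x y z : tensor U V).

HB.instance Definition _ := Choice.on (tensor U V).
HB.instance Definition _ := EqQuotient.on (tensor U V).

Let cl s : tensor U V := \pi_(tensor U V) s.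

Let clP s t : tens_rel s t <-> cl s = cl t.
Proof.
by rewrite /cl; split=> [st|/eqmodP/asboolP//]; apply/eqmodP/asboolP.
Qed.

Let reprP s : tens_rel (repr (cl s)) s.
Proof. by apply/clP; rewrite /cl reprK. Qed.

Definition tadd x y : tensor U V := \pi_(tensor U V) (repr x ++ repr y).
Definition tzero : tensor U V := \pi_(tensor U V) [::].
Definition tscale (a : K) x : tensor U V :=
  \pi_(tensor U V) [seq (a *: p.1, p.2) | p <- repr x].

Let scale_rel a s t : tens_rel s t ->
  tens_rel [seq (a *: p.1, p.2) | p <- s] [seq (a *: p.1, p.2) | p <- t].
Proof.
elim=> {s t} /=.
- by move=> s; exact: TensRefl.
- by move=> s t _; exact: TensSym.
- by move=> s t r _ st _ tr; exact: TensTrans tr.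
- by move=> s s' t t' _ ss _ tt; rewrite !map_cat; exact: TensCat.
- by move=> s t; rewrite !map_cat; exact: TensComm.
- by move=> v; rewrite scaler0; exact: TensZero.
- by move=> u u' v; rewrite scalerDr; exact: TensAddL.
- by move=> u v v'; exact: TensAddR.
- move=> b u v; rewrite scalerA mulrC -scalerA; exact: TensScale.
Qed.

Let taddE s t : tadd (cl s) (cl t) = cl (s ++ t).
Proof. by apply/clP; apply: TensCat; exact: reprP. Qed.

Let tscaleE a s : tscale a (cl s) = cl [seq (a *: p.1, p.2) | p <- s].
Proof. by apply/clP; apply: scale_rel; exact: reprP. Qed.

Let clE x : exists s, x = cl s.
Proof. by exists (repr x); rewrite /cl reprK. Qed.

Let taddA : associative tadd.
Proof.
move=> x y z; case: (clE x) (clE y) (clE z) => s -> [t ->] [r ->].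
by rewrite !taddE catA.
Qed.

Let taddC : commutative tadd.
Proof.
move=> x y; case: (clE x) (clE y) => s -> [t ->].
by rewrite !taddE; apply/clP; exact: TensComm.
Qed.

Let tadd0 : left_id tzero tadd.
Proof. by move=> x; case: (clE x) => s ->; rewrite taddE. Qed.

Let tscale0 x : tscale 0 x = tzero.
Proof.
case: (clE x) => s ->; rewrite tscaleE; apply/clP.
elim: s => [|p s IHs] /=; first exact: TensRefl.
by rewrite -cat1s scale0r -[[::]]cat0s; apply: TensCat => //; exact: TensZero.
Qed.

Let tscaleDl x : {morph tscale^~ x : a b / a + b >-> tadd a b}.
Proof.
move=> a b; case: (clE x) => s -> /=; rewrite !tscaleE taddE; apply/clP.
elim: s => [|p s IHs] /=; first exact: TensRefl.
rewrite scalerDl -cat1s; apply: TensTrans (TensCat (TensAddL _ _ _) IHs) _ => /=.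
rewrite -cat1s -[X in tens_rel _ X]cat1s; apply: TensCat; first exact: TensRefl.
rewrite -cat1s -[_ :: [seq _ | _ <- _]]cat1s !catA.
apply: TensCat; last exact: TensRefl.
exact: TensComm.
Qed.

Let tscale1 : left_id 1 tscale.
Proof.
move=> x; case: (clE x) => s ->; rewrite tscaleE; congr cl.
by rewrite -[RHS]map_id; apply: eq_map => -[u v] /=; rewrite scale1r.
Qed.

Let taddN : left_inverse tzero (tscale (-1)) tadd.
Proof. by move=> x; rewrite -{2}[x]tscale1 -tscaleDl addNr tscale0. Qed.

HB.instance Definition _ :=
  GRing.isZmodule.Build (tensor U V) taddA taddC tadd0 taddN.

Let tscaleA a b x : tscale a (tscale b x) = tscale (a * b) x.
Proof.
case: (clE x) => s ->; rewrite !tscaleE -map_comp; congr cl.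
by apply: eq_map => p /=; rewrite scalerA.
Qed.

Let tscaleDr : right_distributive tscale +%R.
Proof.
move=> a x y; case: (clE x) (clE y) => s -> [t ->].
by rewrite [cl s + cl t]taddE !tscaleE [RHS]taddE map_cat.
Qed.

HB.instance Definition _ := GRing.Zmodule_isLmodule.Build K (tensor U V)
  tscaleA tscale1 tscaleDr tscaleDl.

Definition tens (u : U) (v : V) : tensor U V := \pi_(tensor U V) [:: (u, v)].

Lemma tensDl u u' v : tens (u + u') v = tens u v + tens u' v.
Proof. by rewrite [RHS]taddE; apply/clP; exact: TensAddL. Qed.

Lemma tensDr u v v' : tens u (v + v') = tens u v + tens u v'.
Proof. by rewrite [RHS]taddE; apply/clP; exact: TensAddR. Qed.

Lemma tensZl a u v : tens (a *: u) v = a *: tens u v.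
Proof. by rewrite [RHS]tscaleE. Qed.

Lemma tensZr a u v : tens u (a *: v) = a *: tens u v.
Proof. by rewrite -tensZl; apply/clP/TensSym; exact: TensScale. Qed.

Lemma tens_relP s t :
  tens_rel s t <-> \pi_(tensor U V) s = \pi_(tensor U V) t.
Proof. exact: clP. Qed.

Lemma pi_tensE s : \pi_(tensor U V) s = \sum_(p <- s) tens p.1 p.2.
Proof.
elim: s => [|[u v] s IHs]; first by rewrite big_nil.
by rewrite big_cons -IHs [RHS]taddE.
Qed.

Lemma tensE x : x = \sum_(p <- repr x) tens p.1 p.2.
Proof. by rewrite -pi_tensE reprK. Qed.

Lemma tens_ind (P : tensor U V -> Prop) : P 0 ->
  (forall u v x, P x -> P (tens u v + x)) -> forall x, P x.
Proof.
move=> P0 PD x; rewrite [x]tensE.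
by elim: (repr x) => [|p s IHs]; rewrite ?big_nil ?big_cons //; exact: PD.
Qed.

End Structure.

(* Bilinear maps, and the universal property of the tensor product. *)
Definition bilin (U V W : lmodType K) (f : U -> V -> W) :=
  (forall v, linear (f^~ v)) /\ (forall u, linear (f u)).

Lemma tens_bilin (U V : lmodType K) : bilin (@tens U V).
Proof.
by split=> [v|u] a x y; rewrite ?tensDl ?tensDr ?tensZl ?tensZr.
Qed.

Definition tlift (U V W : lmodType K) (f : U -> V -> W) (x : tensor U V) : W :=
  \sum_(p <- repr x) f p.1 p.2.

Section Lift.
Variables (U V W : lmodType K) (f : U -> V -> W) (bf : bilin f).

Let lin_add (X Y : lmodType K) (g : X -> Y) : linear g ->
  {morph g : x y / x + y}.
Proof. by move=> lg x y; rewrite -[x]scale1r lg !scale1r. Qed.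

Let lin_scale (X Y : lmodType K) (g : X -> Y) : linear g ->
  forall a, {morph g : x / a *: x}.
Proof.
move=> lg a x; have g0 : g 0 = 0.
  by apply/(addrI (g 0)); rewrite -lin_add // !addr0.
by rewrite -[a *: x]addr0 lg g0 addr0.
Qed.

Let lift_rel s t : tens_rel s t ->
  \sum_(p <- s) f p.1 p.2 = \sum_(p <- t) f p.1 p.2.
Proof.
case: bf => bl br; elim=> {s t} //=.
- by move=> s t r _ -> _ ->.
- by move=> s s' t t' _ ss _ tt; rewrite !big_cat /= ss tt.
- by move=> s t; rewrite !big_cat /= addrC.
- move=> v; rewrite big_seq1 big_nil /=.
  by rewrite -[0](scale0r (0 : U)) (lin_scale (bl v)) scale0r.
- by move=> u u' v; rewrite !big_cons !big_nil /= !addr0 (lin_add (bl v)).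
- by move=> u v v'; rewrite !big_cons !big_nil /= !addr0 (lin_add (br u)).
- by move=> a u v; rewrite !big_seq1 /= (lin_scale (bl v)) (lin_scale (br u)).
Qed.

Let tlift_pi s : tlift f (\pi_(tensor U V) s) = \sum_(p <- s) f p.1 p.2.
Proof. by apply: lift_rel; apply/tens_relP; rewrite reprK. Qed.

Lemma tlift_tens u v : tlift f (tens u v) = f u v.
Proof. by rewrite tlift_pi big_seq1. Qed.

Lemma tlift_linear : linear (tlift f).
Proof.
move=> a x y; rewrite -[x]reprK -[y]reprK.
rewrite [a *: _](_ : _ = \pi_(tensor U V) [seq (a *: p.1, p.2) | p <- repr x]); last first.
  by rewrite !pi_tensE big_map scaler_sumr; apply: eq_bigr => p _; rewrite tensZl.
rewrite [_ + _](_ : _ = \pi_(tensor U V) ([seq (a *: p.1, p.2) | p <- repr x] ++ repr y));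
  last by rewrite !pi_tensE big_cat.
rewrite !tlift_pi big_cat big_map scaler_sumr; congr (_ + _).
by apply: eq_bigr => p _ /=; rewrite (lin_scale (bf.1 _)).
Qed.

Lemma tlift_unique (g : {linear tensor U V -> W}) :
  (forall u v, g (tens u v) = f u v) -> g =1 tlift f.
Proof.
by move=> gf x; rewrite {1}[x]tensE raddf_sum; apply: eq_bigr => p _; exact: gf.
Qed.

End Lift.

(* The flip τ : U ⊗ V -> V ⊗ U. *)
Definition tswap (U V : lmodType K) : tensor U V -> tensor V U :=
  tlift (fun u v => tens v u).

(* f ⊗ g. *)
Definition tmap (U V U' V' : lmodType K) (f : U -> U') (g : V -> V') :
  tensor U V -> tensor U' V' := tlift (fun u v => tens (f u) (g v)).

(* Triple tensor products are represented as (U ⊗ V) ⊗ W. *)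
Definition tassoc (U V W : lmodType K) :
    tensor U (tensor V W) -> tensor (tensor U V) W :=
  tlift (fun u => tlift (fun v w => tens (tens u v) w)).

(* (d' ⊗ d'') • (b' ⊗ b'') = (d' ⊗ b') ⊗ (d'' ⊗ b''). *)
Definition bullet (D D' B B' : lmodType K) (x : tensor D D') (y : tensor B B') :
    tensor (tensor D B) (tensor D' B') :=
  tlift (fun d d' => tlift (fun b b' => tens (tens d b) (tens d' b')) y) x.

Lemma bilin_tswap (U V : lmodType K) : bilin (fun (u : U) (v : V) => tens v u).
Proof. by have [l r] := tens_bilin V U; split. Qed.

HB.instance Definition _ (U V : lmodType K) := GRing.isLinear.Build K
  (tensor U V) (tensor V U) *:%R (@tswap U V) (tlift_linear (@bilin_tswap U V)).

Lemma bilin_tmap (U V U' V' : lmodType K)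
  (f : {linear U -> U'}) (g : {linear V -> V'}) :
  bilin (fun u v => tens (f u) (g v)).
Proof.
by split=> [v|u] a x y; rewrite linearP ?tensDl ?tensDr ?tensZl ?tensZr.
Qed.

HB.instance Definition _ (U V U' V' : lmodType K)
    (f : {linear U -> U'}) (g : {linear V -> V'}) :=
  GRing.isLinear.Build K (tensor U V) (tensor U' V') *:%R (tmap f g)
    (tlift_linear (bilin_tmap f g)).

Lemma bilin_tassoc_aux (U V W : lmodType K) (u : U) :
  bilin (fun (v : V) (w : W) => tens (tens u v) w).
Proof.
by split=> [v|w] a x y; rewrite ?(tensDl, tensDr) ?(tensZl, tensZr).
Qed.

Lemma bilin_tassoc (U V W : lmodType K) :
  bilin (fun u : U => tlift (fun (v : V) (w : W) => tens (tens u v) w)).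
Proof.
split=> [x|u]; last exact/tlift_linear/bilin_tassoc_aux.
move=> a u u'; rewrite /tlift scaler_sumr -big_split /=.
by apply: eq_bigr => p _; rewrite !(tensDl, tensZl).
Qed.

HB.instance Definition _ (U V W : lmodType K) := GRing.isLinear.Build K
  (tensor U (tensor V W)) (tensor (tensor U V) W) *:%R (@tassoc U V W)
  (tlift_linear (@bilin_tassoc U V W)).

Lemma bilin_bullet_aux (D D' B B' : lmodType K) (d : D) (d' : D') :
  bilin (fun (b : B) (b' : B') => tens (tens d b) (tens d' b')).
Proof.
by split=> [b|b'] a x y; rewrite ?(tensDl, tensDr) ?(tensZl, tensZr).
Qed.

Lemma bilin_bullet_aux2 (D D' B B' : lmodType K) (y : tensor B B') :
  bilin (fun (d : D) (d' : D') =>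
    tlift (fun b b' => tens (tens d b) (tens d' b')) y).
Proof.
split=> [d'|d] a u v; rewrite /tlift scaler_sumr -big_split /=;
  by apply: eq_bigr => p _; rewrite ?(tensDl, tensDr) ?(tensZl, tensZr).
Qed.

Lemma bilin_bullet (D D' B B' : lmodType K) : bilin (@bullet D D' B B').
Proof.
split=> [y|x]; first exact/tlift_linear/bilin_bullet_aux2.
move=> a y y'; rewrite /bullet /tlift scaler_sumr -big_split /=.
by apply: eq_bigr => p _; exact: (tlift_linear (bilin_bullet_aux B B' p.1 p.2)).
Qed.

Lemma bullet_tens (D D' B B' : lmodType K) (d : D) (d' : D') (b : B) (b' : B') :
  bullet (tens d d') (tens b b') = tens (tens d b) (tens d' b').
Proof.
rewrite /bullet tlift_tens; last exact: bilin_bullet_aux2.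
by rewrite tlift_tens //; exact: bilin_bullet_aux.
Qed.

End Tensor.

Notation "U ⊗ V" := (tensor U V) (at level 40, left associativity) : type_scope.

(* (id ⊗ ν) ν = (ν ⊗ id) ν + (τ ⊗ id) (ν ⊗ id) ν *)
Definition zinbiel (K : fieldType) (B : lmodType K)
    (nu : {linear B -> (B ⊗ B)%type}) : Prop :=
  forall b, tassoc (tmap idfun nu (nu b)) =
    tmap nu idfun (nu b) + tmap (@tswap K B B) idfun (tmap nu idfun (nu b)).

(* A decomposition V = ⊕_{i ∈ Z} V_i: the components with their inclusions
   V_i -> V and projections V -> V_i. *)
Record gradedSpace (K : fieldType) := GradedSpace {
  gspace :> lmodType K;
  gcomp : int -> lmodType K;
  ginj : forall i, {linear gcomp i -> gspace};
  gproj : forall i, {linear gspace -> gcomp i};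
  gproj_inj : forall i, cancel (ginj i) (gproj i);
  gproj_inj0 : forall i j (x : gcomp i), i != j -> gproj j (ginj i x) = 0;
  gproj_fin : forall x, finite_set [set i | gproj i x != 0];
  gsum : forall x, x = \sum_(i \in [set: int]) ginj i (gproj i x)
}.

(* The completed tensor products ∏_{i,j} U_i ⊗ V_j and
   ∏_{i,j,k} (U_i ⊗ V_j) ⊗ W_k. *)
Definition ctensor (K : fieldType) (U V : gradedSpace K) : Type :=
  forall i j : int, (gcomp U i ⊗ gcomp V j)%type.

Definition ctensor3 (K : fieldType) (U V W : gradedSpace K) : Type :=
  forall i j k : int, (gcomp U i ⊗ gcomp V j ⊗ gcomp W k)%type.

Notation "U '⊗^' V" := (ctensor U V) (at level 40, left associativity)
  : type_scope.

Section CompletedTensor.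
Context {K : fieldType}.
Variables U V : gradedSpace K.
Implicit Types x y z : ctensor U V.

HB.instance Definition _ := gen_eqMixin (ctensor U V).
HB.instance Definition _ := gen_choiceMixin (ctensor U V).

Let ctP x y : (forall i j, x i j = y i j) -> x = y.
Proof. by move=> xy; do 2 (apply: functional_extensionality_dep => ?). Qed.

Definition cadd x y : ctensor U V := fun i j => x i j + y i j.
Definition czero : ctensor U V := fun i j => 0.
Definition copp x : ctensor U V := fun i j => - x i j.
Definition cscale (a : K) x : ctensor U V := fun i j => a *: x i j.

Let caddA : associative cadd.
Proof. by move=> x y z; apply: ctP => i j; exact: addrA. Qed.
Let caddC : commutative cadd.
Proof. by move=> x y; apply: ctP => i j; exact: addrC. Qed.
Let cadd0 : left_id czero cadd.
Proof. by move=> x; apply: ctP => i j; exact: add0r. Qed.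
Let caddN : left_inverse czero copp cadd.
Proof. by move=> x; apply: ctP => i j; exact: addNr. Qed.

HB.instance Definition _ :=
  GRing.isZmodule.Build (ctensor U V) caddA caddC cadd0 caddN.

Let cscaleA a b x : cscale a (cscale b x) = cscale (a * b) x.
Proof. by apply: ctP => i j; exact: scalerA. Qed.
Let cscale1 : left_id 1 cscale.
Proof. by move=> x; apply: ctP => i j; exact: scale1r. Qed.
Let cscaleDr : right_distributive cscale +%R.
Proof. by move=> a x y; apply: ctP => i j; exact: scalerDr. Qed.
Let cscaleDl x : {morph cscale^~ x : a b / a + b}.
Proof. by move=> a b; apply: ctP => i j; exact: scalerDl. Qed.

HB.instance Definition _ := GRing.Zmodule_isLmodule.Build K (ctensor U V)
  cscaleA cscale1 cscaleDr cscaleDl.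

(* The image of u ⊗ v in the completed tensor product. *)
Definition ctens (u : U) (v : V) : ctensor U V :=
  fun i j => tens (gproj U i u) (gproj V j v).

(* The formal infinite sum of a family with finitely many nonzero terms in each
   bidegree (\sum_(n \in _) is 0 when infinitely many terms are nonzero). *)
Definition csum (x : int -> ctensor U V) : ctensor U V :=
  fun i j => \sum_(n \in [set: int]) x n i j.

End CompletedTensor.

(* θ ⊗^ id and id ⊗^ θ, for θ : A -> A ⊗^ A, applied to a formal sum
   x ∈ A ⊗^ A: in multidegree (p, q, r) the contribution of x_{n,r} ∈ A_n ⊗ A_r,
   resp. of x_{p,n} ∈ A_p ⊗ A_n, and the sum over n of these contributions. *)
Section Composites.
Context {K : fieldType} {A : gradedSpace K}.

Definition ccomp (theta : {linear A -> (A ⊗^ A)%type}) (n q r : int) :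
    gcomp A n -> (gcomp A q ⊗ gcomp A r)%type :=
  fun a => theta (ginj A n a) q r.

Lemma ccomp_linear theta n q r : linear (@ccomp theta n q r).
Proof. by move=> a x y; rewrite /ccomp !linearP. Qed.

HB.instance Definition _ theta n q r := GRing.isLinear.Build K (gcomp A n)
  (gcomp A q ⊗ gcomp A r)%type *:%R (@ccomp theta n q r)
  (@ccomp_linear theta n q r).

Definition cleft_term (theta : {linear A -> (A ⊗^ A)%type}) (x : (A ⊗^ A)%type)
    (p q r n : int) : (gcomp A p ⊗ gcomp A q ⊗ gcomp A r)%type :=
  tmap (ccomp theta p q) idfun (x n r).

Definition cright_term (theta : {linear A -> (A ⊗^ A)%type}) (x : (A ⊗^ A)%type)
    (p q r n : int) : (gcomp A p ⊗ gcomp A q ⊗ gcomp A r)%type :=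
  tassoc (tmap idfun (ccomp theta q r) (x p n)).

Definition cleft theta x : ctensor3 A A A := fun p q r =>
  \sum_(n \in [set: int]) cleft_term theta x p q r n.

Definition cright theta x : ctensor3 A A A := fun p q r =>
  \sum_(n \in [set: int]) cright_term theta x p q r n.

Definition cleft_defined theta x := forall p q r,
  finite_set [set n | cleft_term theta x p q r n != 0].

Definition cright_defined theta x := forall p q r,
  finite_set [set n | cright_term theta x p q r n != 0].

Implicit Types Delta td tv : {linear A -> (A ⊗^ A)%type}.

Definition completed_coassociative Delta : Prop := forall a : A,
  [/\ cleft_defined Delta (Delta a), cright_defined Delta (Delta a) &
      cleft Delta (Delta a) = cright Delta (Delta a)].

(* td is θ_⊣ and tv is θ_⊢. *)
Definition completed_diassociative td tv : Prop :=
  [/\ completed_coassociative td, completed_coassociative tv &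
  forall d : A,
    [/\ cleft_defined tv (td d), cright_defined tv (td d),
        cleft_defined td (tv d) & cright_defined td (tv d)] /\
    [/\ cleft td (td d) = cright tv (td d),
        cleft tv (td d) = cright td (tv d) &
        cleft td (tv d) = cleft tv (tv d)]].

End Composites.

(* D ⊗ B, graded by the D_i ⊗ B. *)
Section GradedTensor.
Context {K : fieldType}.
Variables (D : gradedSpace K) (B : lmodType K).

Let inj i : {linear gcomp D i ⊗ B -> D ⊗ B} := tmap (ginj D i) idfun.
Let proj i : {linear D ⊗ B -> gcomp D i ⊗ B} := tmap (gproj D i) idfun.

Let injT i d b : inj i (tens d b) = tens (ginj D i d) b.
Proof. by rewrite [LHS]tlift_tens //; exact: bilin_tmap. Qed.

Let projT i d b : proj i (tens d b) = tens (gproj D i d) b.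
Proof. by rewrite [LHS]tlift_tens //; exact: bilin_tmap. Qed.

Let tens0 (U V : lmodType K) (v : V) : tens (0 : U) v = 0.
Proof. by rewrite -[0](scale0r (0 : U)) tensZl scale0r. Qed.

Let proj_inj i : cancel (inj i) (proj i).
Proof.
apply: tens_ind => [|d b x IHx]; first by rewrite !linear0.
by rewrite !linearD IHx injT projT gproj_inj.
Qed.

Let proj_inj0 i j x : i != j -> proj j (inj i x) = 0.
Proof.
move=> ij; move: x; apply: tens_ind => [|d b x IHx]; first by rewrite !linear0.
by rewrite !linearD IHx injT projT gproj_inj0 // tens0 addr0.
Qed.

Let decomp x : exists A : {fset int}, (forall i, i \notin A -> proj i x = 0) /\
  x = \sum_(i \in [set: int]) inj i (proj i x).
Proof.
suff [A [A0 Ax]] : exists A : {fset int}, (forall i, i \notin A -> proj i x = 0)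
    /\ forall A' : {fset int}, (A `<=` A')%fset ->
       x = \sum_(i <- A') inj i (proj i x).
  exists A; split=> //; rewrite (fsbigTE A) //; first exact: Ax.
  by move=> i /A0 ->; rewrite linear0.
move: x; apply: tens_ind => [|d b x [A [A0 Ax]]].
  exists fset0; split=> [i _|A' _]; first by rewrite linear0.
  by rewrite big1 // => i _; rewrite !linear0.
pose S := fset_set [set i | gproj D i d != 0].
have S0 i : i \notin S -> gproj D i d = 0.
  by rewrite in_fset_set ?notin_setE /=; [move=> /negP/negPn/eqP | exact: gproj_fin].
exists (S `|` A)%fset; split=> [i|A' SAA'].
  rewrite inE negb_or => /andP[iS iA].
  by rewrite linearD projT S0 // A0 // tens0 addr0.
have SA' : (S `<=` A')%fset by apply: fsubset_trans SAA'; exact: fsubsetUl.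
have AA' : (A `<=` A')%fset by apply: fsubset_trans SAA'; exact: fsubsetUr.
under eq_bigr do rewrite !linearD.
rewrite big_split /= -Ax //; congr (_ + _).
under eq_bigr do rewrite projT injT.
have tb : {morph (fun d' : D => tens d' b) : u v / u + v} by move=> u v; exact: tensDl.
rewrite -(big_morph _ tb (tens0 D b)); congr tens.
rewrite {1}[d]gsum (fsbigTE A') // => i iA'; rewrite S0 ?linear0 //.
by apply: contra iA'; exact: (fsubsetP SA').
Qed.

Let proj_fin x : finite_set [set i | proj i x != 0].
Proof.
have [A [A0 _]] := decomp x; apply: (sub_finite_set _ (finite_fset A)) => i /=.
by apply: contraNT => /A0 ->.
Qed.

Let sum x : x = \sum_(i \in [set: int]) inj i (proj i x).
Proof. by have [A []] := decomp x. Qed.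

Definition gtensor : gradedSpace K :=
  @GradedSpace K (D ⊗ B)%type (fun i => gcomp D i ⊗ B)%type inj proj
    proj_inj proj_inj0 proj_fin sum.

End GradedTensor.

(* x • y for a formal sum x ∈ D ⊗^ D and y ∈ B ⊗ B. *)
Definition cbullet (K : fieldType) (D : gradedSpace K) (B : lmodType K)
    (x : (D ⊗^ D)%type) (y : (B ⊗ B)%type) : (gtensor D B ⊗^ gtensor D B)%type :=
  fun i j => bullet (x i j) y.

(* Δ(d ⊗ b) = θ_⊢(d) • ν(b) + θ_⊣(d) • τ(ν(b)), with td = θ_⊣ and tv = θ_⊢. *)
Section Delta.
Context {K : fieldType} {D : gradedSpace K} {B : lmodType K}.
Variables (td tv : {linear D -> (D ⊗^ D)%type}) (nu : {linear B -> (B ⊗ B)%type}).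

Definition Delta : gtensor D B -> (gtensor D B ⊗^ gtensor D B)%type :=
  tlift (fun (d : D) (b : B) =>
    cbullet (tv d) (nu b) + cbullet (td d) (tswap (nu b))).

Lemma bilin_cbullet : bilin (@cbullet K D B).
Proof.
split=> [y|x] a u v; apply: functional_extensionality_dep => i;
  apply: functional_extensionality_dep => j.
- exact: (bilin_bullet _ _ _ _).1.
- exact: (bilin_bullet _ _ _ _).2.
Qed.

Lemma bilin_Delta : bilin (fun (d : D) (b : B) =>
  cbullet (tv d) (nu b) + cbullet (td d) (tswap (nu b))).
Proof.
have [bl br] := bilin_cbullet.
by split=> [b|d] a x y; rewrite !linearP ?bl ?br scalerDr addrACA.
Qed.

HB.instance Definition _ := GRing.isLinear.Build K (gtensor D B)
  (gtensor D B ⊗^ gtensor D B)%type *:%R Delta (tlift_linear bilin_Delta).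

Lemma Delta_tens d b : Delta (tens d b) =
  cbullet (tv d) (nu b) + cbullet (td d) (tswap (nu b)).
Proof. exact: tlift_tens bilin_Delta _ _. Qed.

End Delta.

(* The space {f1 ∂_1 + f2 ∂_2 | f1, f2 ∈ K[t, t^-1]}: the Laurent polynomial
   \sum_i a_i t^i is the finitely supported function i |-> a_i, and
   f1 ∂_1 + f2 ∂_2 is the pair (f1, f2). *)
Section Laurent.
Context {K : fieldType}.

Definition laurent : lmodType K := {malg K[int]}.
Definition laurentD : lmodType K := (laurent * laurent)%type.

(* t^i ∂_1 and t^i ∂_2 *)
Definition dx (i : int) : laurentD := (<< i >>, 0).
Definition dy (i : int) : laurentD := (0, << i >>).

(* The component D_i = span{t^(i-1) ∂_1, t^i ∂_2}, in coordinates. *)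
Definition Dcomp : lmodType K := (K^o * K^o)%type.
Definition Dinj (i : int) (c : Dcomp) : laurentD :=
  c.1 *: dx (i - 1) + c.2 *: dy i.
Definition Dproj (i : int) (f : laurentD) : Dcomp :=
  (f.1@_(i - 1), f.2@_i).

Let Dinj_linear i : linear (Dinj i).
Proof.
move=> a c d; rewrite /Dinj /= !scalerDl !scalerDr !scalerA addrACA //.
Qed.
Let Dproj_linear i : linear (Dproj i).
Proof. by move=> a f g; rewrite /Dproj /= !mcoeffD !mcoeffZ. Qed.

HB.instance Definition _ i := GRing.isLinear.Build K Dcomp laurentD *:%R
  (Dinj i) (Dinj_linear i).
HB.instance Definition _ i := GRing.isLinear.Build K laurentD Dcomp *:%R
  (Dproj i) (Dproj_linear i).

Let Dproj_inj i : cancel (Dinj i) (Dproj i).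
Proof.
case=> a b; rewrite /Dproj /Dinj /= !scaler0 addr0 add0r !mcoeffZ !mcoeffUU.
by rewrite !mulr1.
Qed.

Let Dproj_inj0 i j (c : Dcomp) : i != j -> Dproj j (Dinj i c) = 0.
Proof.
move=> ij; rewrite /Dproj /Dinj /= !scaler0 addr0 add0r !mcoeffZ !mcoeffU.
by rewrite (inj_eq (addIr _)) (negPf ij) !mulr0.
Qed.

Let Dsupp (f : laurentD) : {fset int} :=
  ([fset (i + 1 : int) | i : int in msupp f.1] `|` msupp f.2)%fset.

Let Dproj_out f i : i \notin Dsupp f -> Dproj i f = 0.
Proof.
rewrite inE negb_or => /andP[i1 i2]; rewrite /Dproj [f.2@_i]mcoeff_outdom //.
rewrite mcoeff_outdom //; apply: contra i1 => i1.
by apply/imfsetP; exists (i - 1); rewrite ?subrK.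
Qed.

Let Dproj_fin f : finite_set [set i | Dproj i f != 0].
Proof.
apply: (sub_finite_set _ (finite_fset (Dsupp f))) => i /=.
by apply: contraNT => /Dproj_out ->.
Qed.

Let pair_morph1 : {morph (fst : laurentD -> laurent) : x y / x + y}.
Proof. by []. Qed.
Let pair_morph2 : {morph (snd : laurentD -> laurent) : x y / x + y}.
Proof. by []. Qed.

Let zero1 : (0 : laurentD).1 = 0. Proof. by []. Qed.
Let zero2 : (0 : laurentD).2 = 0. Proof. by []. Qed.

Let Dsum (f : laurentD) : f = \sum_(i \in [set: int]) Dinj i (Dproj i f).
Proof.
rewrite (fsbigTE (Dsupp f)) => [|i /Dproj_out ->]; last first.
  by rewrite linear0.
rewrite [RHS]surjective_pairing (big_morph _ pair_morph1 zero1).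
rewrite (big_morph _ pair_morph2 zero2) [LHS]surjective_pairing.
congr pair; apply/malgP => k.
  rewrite (raddf_sum (mcoeff k)) /=.
  under eq_bigr do rewrite scaler0 addr0 mcoeffZ mcoeffU.
  have [kS|kS] := boolP (k + 1 \in Dsupp f).
    rewrite (bigD1_seq (k + 1)) ?fset_uniq //= addrK eqxx mulr1 big1 ?addr0 // => i ik.
    by rewrite subr_eq (negPf ik) mulr0.
  have /(congr1 fst) := Dproj_out kS; rewrite /Dproj /= addrK => ->.
  rewrite big_seq big1 // => i iS; rewrite subr_eq.
  by case: eqP iS kS => [->|_ _ _]; [move=> -> | rewrite mulr0].
rewrite (raddf_sum (mcoeff k)) /=.
under eq_bigr do rewrite scaler0 add0r mcoeffZ mcoeffU.
have [kS|kS] := boolP (k \in Dsupp f).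
  rewrite (bigD1_seq k) ?fset_uniq //= eqxx mulr1 big1 ?addr0 // => i ik.
  by rewrite (negPf ik) mulr0.
have /(congr1 snd) := Dproj_out kS; rewrite /Dproj /= => ->.
rewrite big_seq big1 // => i iS.
by case: eqP iS kS => [->|_ _ _]; [move=> -> | rewrite mulr0].
Qed.

Definition gradedD : gradedSpace K :=
  @GradedSpace K laurentD (fun=> Dcomp) Dinj Dproj
    Dproj_inj Dproj_inj0 Dproj_fin Dsum.

(* The linear map with t^i ∂_1 |-> g1 i and t^i ∂_2 |-> g2 i. *)
Definition Dextend (W : lmodType K) (g1 g2 : int -> W) (f : gradedD) : W :=
  \sum_(i \in [set: int]) f.1@_i *: g1 i +
  \sum_(i \in [set: int]) f.2@_i *: g2 i.

Let ext_linear (W : lmodType K) (g : int -> W) :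
  linear (fun f : laurent => \sum_(i \in [set: int]) f@_i *: g i).
Proof.
move=> a x y; pose A := (msupp x `|` msupp y)%fset.
have xA i : i \notin A -> x@_i = 0.
  by rewrite inE negb_or => /andP[ix _]; rewrite mcoeff_outdom.
have yA i : i \notin A -> y@_i = 0.
  by rewrite inE negb_or => /andP[_ iy]; rewrite mcoeff_outdom.
rewrite !(fsbigTE A); first last.
- by move=> i iA; rewrite mcoeffD mcoeffZ xA // yA // mulr0 addr0 scale0r.
- by move=> i iA; rewrite xA // scale0r.
- by move=> i iA; rewrite yA // scale0r.
rewrite scaler_sumr -big_split; apply: eq_bigr => i _ /=.
by rewrite mcoeffD mcoeffZ scalerDl scalerA.
Qed.

Let Dextend_linear (W : lmodType K) (g1 g2 : int -> W) : linear (Dextend g1 g2).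
Proof.
move=> a x y.
apply: (etrans (congr2 +%R (ext_linear g1 a x.1 y.1) (ext_linear g2 a x.2 y.2))).
by rewrite addrACA -scalerDr.
Qed.

HB.instance Definition _ (W : lmodType K) (g1 g2 : int -> W) :=
  GRing.isLinear.Build K gradedD W *:%R (Dextend g1 g2)
    (Dextend_linear g1 g2).

Let ext_mono (W : lmodType K) (g : int -> W) i :
  \sum_(k \in [set: int]) (<< i >> : laurent)@_k *: g k = g i.
Proof.
rewrite (fsbigTE [fset i]%fset) => [|k]; last first.
  by rewrite inE mcoeffU eq_sym => /negPf ->; rewrite scale0r.
by rewrite big_seq_fset1 mcoeffUU scale1r.
Qed.

Let ext_zero (W : lmodType K) (g : int -> W) :
  \sum_(k \in [set: int]) (0 : laurent)@_k *: g k = 0.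
Proof. by rewrite fsbig1 // => k _; rewrite mcoeff0 scale0r. Qed.

Lemma Dextend_dx (W : lmodType K) (g1 g2 : int -> W) i :
  Dextend g1 g2 (dx i) = g1 i.
Proof. by rewrite /Dextend /dx /= ext_mono ext_zero addr0. Qed.

Lemma Dextend_dy (W : lmodType K) (g1 g2 : int -> W) i :
  Dextend g1 g2 (dy i) = g2 i.
Proof. by rewrite /Dextend /dy /= (ext_zero g1) (ext_mono g2) add0r. Qed.

Local Notation "u ⊗' v" := (@ctens K gradedD gradedD u v) (at level 40).

Definition theta_dashv : {linear gradedD -> (gradedD ⊗^ gradedD)%type} :=
  Dextend
    (fun i => csum (fun j => dx (- j) ⊗' dx (i + j) - dx (- j) ⊗' dy (i + j + 1)))
    (fun i => csum (fun j => dy (- j) ⊗' dx (i + j) - dy (- j) ⊗' dy (i + j + 1))).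

Definition theta_vdash : {linear gradedD -> (gradedD ⊗^ gradedD)%type} :=
  Dextend
    (fun i => csum (fun j => dx (- j) ⊗' dx (i + j) - dy (- j) ⊗' dx (i + j + 1)))
    (fun i => csum (fun j => dx (- j) ⊗' dy (i + j) - dy (- j) ⊗' dy (i + j + 1))).

Lemma theta_dashv_dx i : theta_dashv (dx i) =
  csum (fun j => dx (- j) ⊗' dx (i + j) - dx (- j) ⊗' dy (i + j + 1)).
Proof. exact: Dextend_dx. Qed.

Lemma theta_dashv_dy i : theta_dashv (dy i) =
  csum (fun j => dy (- j) ⊗' dx (i + j) - dy (- j) ⊗' dy (i + j + 1)).
Proof. exact: Dextend_dy. Qed.

Lemma theta_vdash_dx i : theta_vdash (dx i) =
  csum (fun j => dx (- j) ⊗' dx (i + j) - dy (- j) ⊗' dx (i + j + 1)).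
Proof. exact: Dextend_dx. Qed.

Lemma theta_vdash_dy i : theta_vdash (dy i) =
  csum (fun j => dx (- j) ⊗' dy (i + j) - dy (- j) ⊗' dy (i + j + 1)).
Proof. exact: Dextend_dy. Qed.

End Laurent.

Arguments gradedD K : clear implicits.
Arguments theta_dashv K : clear implicits.
Arguments theta_vdash K : clear implicits.

(* Main.v *)
Require Import Defs.
From HB Require Import structures.
From mathcomp Require Import all_boot all_algebra.
From mathcomp Require Import zify.
From mathcomp Require Import finmap boolp classical_sets cardinality fsbigop.
From mathcomp.multinomials Require Import monalg.

Set Implicit Arguments.
Unset Strict Implicit.
Unset Printing Implicit Defensive.

Import GRing.Theory.
Local Open Scope ring_scope.

(** Up to the regrouping [bullet3] of triple tensors, each side of the
    coassociativity of Δ is a sum of four terms (θ_1 ⊗ id) θ_2 (d) • Y, resp.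
    (id ⊗ θ_1) θ_2 (d) • Y.  By the diassociative axioms only three elements of
    D ⊗ D ⊗ D occur, namely (θ_⊢ ⊗ id) θ_⊢ (d), (θ_⊢ ⊗ id) θ_⊣ (d) and
    (θ_⊣ ⊗ id) θ_⊣ (d); equating their cofactors in B ⊗ B ⊗ B gives the Zinbiel
    identity and two of its consequences, obtained by permuting factors.

    For the Laurent coalgebra, in the basis t^(i-1) ∂_1, t^i ∂_2 of each D_i, and
    with w = (1, -1), one has θ_⊣ (c) = c ⊗ w and θ_⊢ (c) = w ⊗ c in every
    bidegree.  For c = (1, 0) the three elements above are w ⊗ w ⊗ c, w ⊗ c ⊗ w
    and c ⊗ w ⊗ w, which are linearly independent, so that coassociativity forces
    the Zinbiel identity. *)

Section FiniteSupportSums.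
Variables (I : choiceType).

Lemma finite_support0 (V : zmodType) : finite_set [set i : I | (0 : V) != 0].
Proof. by apply: (sub_finite_set _ (finite_set0 I)) => i /=; rewrite eqxx. Qed.

Lemma finite_supportD (V : zmodType) (F G : I -> V) :
  finite_set [set i | F i != 0] -> finite_set [set i | G i != 0] ->
  finite_set [set i | F i + G i != 0].
Proof.
move=> fF fG; have fFG : finite_set ([set i | F i != 0] `|` [set i | G i != 0])%classic.
  by rewrite finite_setU.
apply: (sub_finite_set _ fFG) => i /= FGi.
by have [F0|nF] := eqVneq (F i) 0; [right; move: FGi; rewrite F0 add0r|left].
Qed.

Lemma finite_support_raddf (V W : zmodType) (f : {additive V -> W}) (F : I -> V) :
  finite_set [set i | F i != 0] -> finite_set [set i | f (F i) != 0].
Proof.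
move=> fF; apply: (sub_finite_set _ fF) => i /=.
by apply: contraNneq => ->; rewrite raddf0.
Qed.

Lemma notin_support (V : zmodType) (F : I -> V) (fF : finite_set [set i | F i != 0]) i :
  i \notin fset_set [set i | F i != 0] -> F i = 0.
Proof. by rewrite in_fset_set ?notin_setE //= => /negP/negPn/eqP. Qed.

Lemma fsumD (V : zmodType) (F G : I -> V) :
  finite_set [set i | F i != 0] -> finite_set [set i | G i != 0] ->
  \sum_(i \in [set: I]) (F i + G i) =
  \sum_(i \in [set: I]) F i + \sum_(i \in [set: I]) G i.
Proof.
move=> fF fG.
pose A := (fset_set [set i | F i != 0] `|` fset_set [set i | G i != 0])%fset.
have F0 i : i \notin A -> F i = 0.
  by rewrite inE negb_or => /andP[/notin_support -> ].
have G0 i : i \notin A -> G i = 0.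
  by rewrite inE negb_or => /andP[_ /notin_support -> ].
rewrite !(fsbigTE A) // ?big_split // => i iA.
by rewrite F0 // G0 // addr0.
Qed.

Lemma raddf_fsum (V W : zmodType) (f : {additive V -> W}) (F : I -> V) :
  finite_set [set i | F i != 0] ->
  f (\sum_(i \in [set: I]) F i) = \sum_(i \in [set: I]) f (F i).
Proof.
move=> fF; have F0 := notin_support fF.
rewrite !(fsbigTE (fset_set [set i | F i != 0])) ?raddf_sum // => i /F0 ->.
by rewrite raddf0.
Qed.

Lemma fsum_single (V : zmodType) (F : I -> V) i0 :
  (forall i, i != i0 -> F i = 0) -> \sum_(i \in [set: I]) F i = F i0.
Proof.
move=> F0; rewrite (fsbigTE [fset i0]%fset) ?big_seq_fset1 // => i.
by rewrite inE; exact: F0.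
Qed.

Lemma finite_support_single (V : zmodType) (F : I -> V) i0 :
  (forall i, i != i0 -> F i = 0) -> finite_set [set i | F i != 0].
Proof.
move=> F0; apply: (sub_finite_set _ (finite_set1 i0)) => i /=.
by apply: contraNeq => /F0 ->.
Qed.

End FiniteSupportSums.

Section Bilinear.
Context {K : fieldType}.
Implicit Types U V W : lmodType K.

Lemma tens0l U V (v : V) : tens (0 : U) v = 0.
Proof. by rewrite -[0](scale0r (0 : U)) tensZl scale0r. Qed.

Lemma tens0r U V (u : U) : tens u (0 : V) = 0.
Proof. by rewrite -[0](scale0r (0 : V)) tensZr scale0r. Qed.

HB.instance Definition _ U V (u : U) := GRing.isLinear.Build K V (U ⊗ V)%type
  *:%R (@tens K U V u) ((tens_bilin U V).2 u).

Lemma tmap_tens U V U' V' (f : {linear U -> U'}) (g : {linear V -> V'}) u v :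
  tmap f g (tens u v) = tens (f u) (g v).
Proof. exact: tlift_tens (bilin_tmap f g) _ _. Qed.

Lemma tswap_tens U V (u : U) (v : V) : tswap (tens u v) = tens v u.
Proof. exact: tlift_tens (@bilin_tswap _ U V) _ _. Qed.

Lemma tassoc_tens U V W (u : U) (v : V) (w : W) :
  tassoc (tens u (tens v w)) = tens (tens u v) w.
Proof.
by rewrite /tassoc (tlift_tens (@bilin_tassoc _ U V W)) (tlift_tens (bilin_tassoc_aux _ _ _)).
Qed.

Lemma tensor_ext U V W (f g : {linear (U ⊗ V)%type -> W}) :
  (forall u v, f (tens u v) = g (tens u v)) -> f =1 g.
Proof.
move=> fg; apply: tens_ind => [|u v x IH]; first by rewrite !linear0.
by rewrite !linearD fg IH.
Qed.

Lemma bilin_comp U V W W' (h : {linear W -> W'}) (f : U -> V -> W) :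
  bilin f -> bilin (fun u v => h (f u v)).
Proof. by move=> [fl fr]; split=> [v|u] a x y; rewrite ?fl ?fr linearP. Qed.

Lemma bilin_pre U V U' V' W (g : {linear U' -> U}) (h : {linear V' -> V})
  (f : U -> V -> W) : bilin f -> bilin (fun u v => f (g u) (h v)).
Proof. by move=> [fl fr]; split=> [v|u] a x y; rewrite linearP ?fl ?fr. Qed.

Lemma bilinD U V W (f g : U -> V -> W) :
  bilin f -> bilin g -> bilin (fun u v => f u v + g u v).
Proof.
move=> [fl fr] [gl gr]; split=> [v|u] a x y.
- by rewrite fl gl scalerDr addrACA.
- by rewrite fr gr scalerDr addrACA.
Qed.

Lemma bilin_addl U V W (f : U -> V -> W) v :
  bilin f -> {morph f^~ v : x y / x + y}.
Proof. by move=> [fl _] x y; have := fl v 1 x y; rewrite !scale1r. Qed.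

Lemma bilin_addr U V W (f : U -> V -> W) u :
  bilin f -> {morph f u : x y / x + y}.
Proof. by move=> [_ fr] x y; have := fr u 1 x y; rewrite !scale1r. Qed.

Lemma bilin0l U V W (f : U -> V -> W) v : bilin f -> f 0 v = 0.
Proof.
by move=> bf; apply: (addrI (f 0 v)); rewrite -(bilin_addl v bf) !addr0.
Qed.

Lemma bilin0r U V W (f : U -> V -> W) u : bilin f -> f u 0 = 0.
Proof.
by move=> bf; apply: (addrI (f u 0)); rewrite -(bilin_addr u bf) !addr0.
Qed.

Lemma bilin_tensor_ext U V U' V' W (f g : (U ⊗ V)%type -> (U' ⊗ V')%type -> W) :
  bilin f -> bilin g ->
  (forall u v u' v', f (tens u v) (tens u' v') = g (tens u v) (tens u' v')) ->
  forall x y, f x y = g x y.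
Proof.
move=> bf bg fg x y; move: x; apply: tens_ind => [|u v x IHx].
  by rewrite (bilin0l y bf) (bilin0l y bg).
rewrite (bilin_addl y bf) (bilin_addl y bg) /= IHx; congr (_ + _).
move: y {IHx}; apply: tens_ind => [|u' v' y IHy]; first by rewrite (bilin0r _ bf) (bilin0r _ bg).
by rewrite (bilin_addr _ bf) (bilin_addr _ bg) fg IHy.
Qed.

End Bilinear.

Section TripleBullet.
Context {K : fieldType}.
Implicit Types D B : lmodType K.

Definition tbullet D D' B B' :
    (D ⊗ D' ⊗ (B ⊗ B'))%type -> (D ⊗ B ⊗ (D' ⊗ B'))%type :=
  tlift (@bullet K D D' B B').

HB.instance Definition _ D D' B B' := GRing.isLinear.Build K
  (D ⊗ D' ⊗ (B ⊗ B'))%type (D ⊗ B ⊗ (D' ⊗ B'))%type *:%R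
  (@tbullet D D' B B') (tlift_linear (@bilin_bullet K D D' B B')).

Lemma tbullet_tens D D' B B' (x : (D ⊗ D')%type) (y : (B ⊗ B')%type) :
  tbullet (tens x y) = bullet x y.
Proof. exact: tlift_tens (@bilin_bullet K D D' B B') _ _. Qed.

Definition bullet3 D1 D2 D3 B1 B2 B3 (x : (D1 ⊗ D2 ⊗ D3)%type)
    (y : (B1 ⊗ B2 ⊗ B3)%type) : (D1 ⊗ B1 ⊗ (D2 ⊗ B2) ⊗ (D3 ⊗ B3))%type :=
  tmap (@tbullet D1 D2 B1 B2) idfun (bullet x y).

Lemma bilin_bullet3 D1 D2 D3 B1 B2 B3 : bilin (@bullet3 D1 D2 D3 B1 B2 B3).
Proof. exact: (bilin_comp (tmap (@tbullet D1 D2 B1 B2) idfun) (@bilin_bullet K _ _ _ _)). Qed.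

HB.instance Definition _ D1 D2 D3 B1 B2 B3 (x : (D1 ⊗ D2 ⊗ D3)%type) :=
  GRing.isLinear.Build K (B1 ⊗ B2 ⊗ B3)%type _ *:%R (@bullet3 D1 D2 D3 B1 B2 B3 x)
    ((@bilin_bullet3 D1 D2 D3 B1 B2 B3).2 x).

Definition bullet3l D1 D2 D3 B1 B2 B3 y :=
  (@bullet3 D1 D2 D3 B1 B2 B3)^~ y.

HB.instance Definition _ D1 D2 D3 B1 B2 B3 (y : (B1 ⊗ B2 ⊗ B3)%type) :=
  GRing.isLinear.Build K (D1 ⊗ D2 ⊗ D3)%type _ *:%R (@bullet3l D1 D2 D3 B1 B2 B3 y)
    ((@bilin_bullet3 D1 D2 D3 B1 B2 B3).1 y).

Lemma bullet3_tens D1 D2 D3 B1 B2 B3 (x : (D1 ⊗ D2)%type) (d : D3)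
    (y : (B1 ⊗ B2)%type) (b : B3) :
  bullet3 (tens x d) (tens y b) = tens (bullet x y) (tens d b).
Proof.
by rewrite /bullet3 bullet_tens tmap_tens /= tbullet_tens.
Qed.

Lemma tassoc_bullet3 D1 D2 D3 B1 B2 B3 (d : D1) (x : (D2 ⊗ D3)%type) (b : B1)
    (y : (B2 ⊗ B3)%type) :
  tassoc (tens (tens d b) (bullet x y)) =
  bullet3 (tassoc (tens d x)) (tassoc (tens b y)).
Proof.
apply: (bilin_tensor_ext (f := fun x y => tassoc (tens (tens d b) (bullet x y)))
  (g := fun x y => bullet3 ((@tassoc K D1 D2 D3 \o tens d) x) ((@tassoc K B1 B2 B3 \o tens b) y))).
- apply: (bilin_comp (@tassoc K _ _ _ \o tens (tens d b))); exact: bilin_bullet.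
- exact/bilin_pre/bilin_bullet3.
by move=> d2 d3 b2 b3; rewrite /= bullet_tens !tassoc_tens bullet3_tens bullet_tens.
Qed.

End TripleBullet.

Section DeltaComposites.
Context {K : fieldType} {D : gradedSpace K} {B : lmodType K}.
Variables (td tv : {linear D -> (D ⊗^ D)%type}) (nu : {linear B -> (B ⊗ B)%type}).

Let cDelta n p q : {linear gcomp (gtensor D B) n ->
    (gcomp (gtensor D B) p ⊗ gcomp (gtensor D B) q)%type} :=
  ccomp (Delta td tv nu) p q.

Lemma ccomp_Delta n p q (d : gcomp D n) (b : B) :
  ccomp (Delta td tv nu) p q (tens d b : gcomp (gtensor D B) n) =
  bullet (ccomp tv p q d) (nu b) + bullet (ccomp td p q d) (tswap (nu b)).
Proof.
rewrite /ccomp.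
have -> : ginj (gtensor D B) n (tens d b) = tens (ginj D n d) b.
  exact: tmap_tens.
exact: (congr1 (fun x => x p q) (Delta_tens td tv nu (ginj D n d) b)).
Qed.

Lemma ccomp_Delta_left n p q r (x : (gcomp D n ⊗ gcomp D r)%type) (y : (B ⊗ B)%type) :
  tmap (ccomp (Delta td tv nu) (n := n) p q) idfun (bullet x y) =
  bullet3 (tmap (ccomp tv p q) idfun x) (tmap nu idfun y) +
  bullet3 (tmap (ccomp td p q) idfun x) (tmap (@tswap K B B \o nu) idfun y)
  :> (gcomp D p ⊗ B ⊗ (gcomp D q ⊗ B) ⊗ (gcomp D r ⊗ B))%type.
Proof.
pose F : {linear (gcomp D n ⊗ B)%type -> (gcomp D p ⊗ B ⊗ (gcomp D q ⊗ B))%type} :=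
  cDelta n p q.
move: x y; apply: bilin_tensor_ext.
- exact: (bilin_comp (tmap F idfun) (@bilin_bullet K _ _ _ _)).
- apply: bilinD.
  + exact: (bilin_pre (tmap (ccomp tv p q) idfun) (tmap nu idfun) (@bilin_bullet3 _ _ _ _ _ _ _)).
  + exact: (bilin_pre (tmap (ccomp td p q) idfun) (tmap (@tswap K B B \o nu) idfun)
     (@bilin_bullet3 _ _ _ _ _ _ _)).
move=> d d' b b'; rewrite bullet_tens (tmap_tens F) !tmap_tens !bullet3_tens -tensDl.
by congr tens; exact: ccomp_Delta.
Qed.

Lemma ccomp_Delta_right n p q r (x : (gcomp D p ⊗ gcomp D n)%type) (y : (B ⊗ B)%type) :
  tassoc (tmap idfun (ccomp (Delta td tv nu) (n := n) q r) (bullet x y)) =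
  bullet3 (tassoc (tmap idfun (ccomp tv q r) x)) (tassoc (tmap idfun nu y)) +
  bullet3 (tassoc (tmap idfun (ccomp td q r) x))
    (tassoc (tmap idfun (@tswap K B B \o nu) y))
  :> (gcomp D p ⊗ B ⊗ (gcomp D q ⊗ B) ⊗ (gcomp D r ⊗ B))%type.
Proof.
pose F : {linear (gcomp D n ⊗ B)%type -> (gcomp D q ⊗ B ⊗ (gcomp D r ⊗ B))%type} :=
  cDelta n q r.
move: x y; apply: bilin_tensor_ext.
- exact: (bilin_comp (@tassoc K _ _ _ \o tmap idfun F) (@bilin_bullet K _ _ _ _)).
- apply: bilinD.
  + exact: (bilin_pre (@tassoc K _ _ _ \o tmap idfun (ccomp tv q r))
      (@tassoc K _ _ _ \o tmap idfun nu) (@bilin_bullet3 _ _ _ _ _ _ _)).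
  + exact: (bilin_pre (@tassoc K _ _ _ \o tmap idfun (ccomp td q r))
      (@tassoc K _ _ _ \o tmap idfun (@tswap K B B \o nu)) (@bilin_bullet3 _ _ _ _ _ _ _)).
move=> d d' b b'; rewrite bullet_tens (tmap_tens idfun F) !tmap_tens -!tassoc_bullet3.
by rewrite -linearD -tensDr; congr (tassoc (tens _ _)); exact: ccomp_Delta.
Qed.

Lemma cleft_term_Delta d b p q r n :
  cleft_term (Delta td tv nu) (Delta td tv nu (tens d b)) p q r n =
  (bullet3 (cleft_term tv (tv d) p q r n) (tmap nu idfun (nu b)) +
   bullet3 (cleft_term td (tv d) p q r n) (tmap (@tswap K B B \o nu) idfun (nu b))) +
  (bullet3 (cleft_term tv (td d) p q r n) (tmap nu idfun (tswap (nu b))) +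
   bullet3 (cleft_term td (td d) p q r n)
     (tmap (@tswap K B B \o nu) idfun (tswap (nu b))))
  :> (gcomp D p ⊗ B ⊗ (gcomp D q ⊗ B) ⊗ (gcomp D r ⊗ B))%type.
Proof.
pose F : {linear (gcomp D n ⊗ B)%type -> (gcomp D p ⊗ B ⊗ (gcomp D q ⊗ B))%type} :=
  cDelta n p q.
rewrite Delta_tens; apply: etrans (linearD (tmap F idfun) _ _) _.
by congr (_ + _); exact: ccomp_Delta_left.
Qed.

Lemma cright_term_Delta d b p q r n :
  cright_term (Delta td tv nu) (Delta td tv nu (tens d b)) p q r n =
  (bullet3 (cright_term tv (tv d) p q r n) (tassoc (tmap idfun nu (nu b))) +
   bullet3 (cright_term td (tv d) p q r n)
     (tassoc (tmap idfun (@tswap K B B \o nu) (nu b)))) +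
  (bullet3 (cright_term tv (td d) p q r n) (tassoc (tmap idfun nu (tswap (nu b)))) +
   bullet3 (cright_term td (td d) p q r n)
     (tassoc (tmap idfun (@tswap K B B \o nu) (tswap (nu b)))))
  :> (gcomp D p ⊗ B ⊗ (gcomp D q ⊗ B) ⊗ (gcomp D r ⊗ B))%type.
Proof.
pose F : {linear (gcomp D n ⊗ B)%type -> (gcomp D q ⊗ B ⊗ (gcomp D r ⊗ B))%type} :=
  cDelta n q r.
rewrite Delta_tens; apply: etrans (linearD (@tassoc K _ _ _ \o tmap idfun F) _ _) _.
by congr (_ + _); exact: ccomp_Delta_right.
Qed.

End DeltaComposites.

Section TensorCube.
Context {K : fieldType}.
Implicit Types U V : lmodType K.

Definition cycle3 U : (U ⊗ U ⊗ U)%type -> (U ⊗ U ⊗ U)%type :=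
  @tassoc K U U U \o @tswap K _ _.
Definition swap12 U : (U ⊗ U ⊗ U)%type -> (U ⊗ U ⊗ U)%type := tmap (@tswap K U U) idfun.

HB.instance Definition _ U := GRing.Linear.on (@cycle3 U).
HB.instance Definition _ U := GRing.Linear.on (@swap12 U).

Lemma cycle3_tens U (u v w : U) :
  cycle3 (tens (tens u v) w) = tens (tens w u) v.
Proof. exact: etrans (congr1 (@tassoc K U U U) (tswap_tens _ _)) (tassoc_tens _ _ _). Qed.

Lemma swap12_tens U (u v w : U) :
  swap12 (tens (tens u v) w) = tens (tens v u) w.
Proof. by rewrite /swap12 tmap_tens /= tswap_tens. Qed.

Lemma tensor3_ext U V (f g : {linear (U ⊗ U ⊗ U)%type -> V}) :
  (forall u v w, f (tens (tens u v) w) = g (tens (tens u v) w)) -> f =1 g.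
Proof.
move=> fg; apply: tensor_ext => x w; move: x.
apply: tens_ind => [|u v x IH]; first by rewrite tens0l !linear0.
by rewrite tensDl !linearD IH fg.
Qed.

Lemma swap12K U : involutive (@swap12 U).
Proof.
apply: (tensor3_ext (f := @swap12 U \o @swap12 U) (g := idfun)) => u v w.
by rewrite /= !swap12_tens.
Qed.

Lemma cycle3_swap12 U x : swap12 (cycle3 (cycle3 x)) = cycle3 (@swap12 U x).
Proof.
apply: (tensor3_ext (f := @swap12 U \o (@cycle3 U \o @cycle3 U)) (g := @cycle3 U \o @swap12 U)).
by move=> u v w; rewrite /= !(cycle3_tens, swap12_tens).
Qed.

Variables (U : lmodType K) (f : {linear U -> (U ⊗ U)%type}).

Lemma tmap_tswap_comp x :
  tmap (@tswap K U U \o f) idfun x = swap12 (tmap f idfun x).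
Proof.
apply: (tensor_ext (f := tmap (@tswap K U U \o f) idfun)
  (g := @swap12 U \o tmap f idfun)) => u v.
by rewrite /= !tmap_tens /swap12 tmap_tens.
Qed.

Lemma tassoc_tmap_tswap x :
  tassoc (tmap idfun f (tswap x)) = cycle3 (tmap f idfun x).
Proof.
apply: (tensor_ext (f := @tassoc K U U U \o (tmap idfun f \o @tswap K U U))
  (g := @cycle3 U \o tmap f idfun)) => u v.
by rewrite /= tswap_tens !tmap_tens; congr (@tassoc K U U U); rewrite tswap_tens.
Qed.

Lemma tmap_tswap x :
  tmap f idfun (tswap x) = cycle3 (cycle3 (tassoc (tmap idfun f x))).
Proof.
apply: (tensor_ext (f := tmap f idfun \o @tswap K U U)
  (g := @cycle3 U \o (@cycle3 U \o (@tassoc K U U U \o tmap idfun f)))) => u v.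
rewrite /= tswap_tens !tmap_tens /=; move: (f v).
apply: tens_ind => [|x1 x2 y IH]; first by rewrite tens0l tens0r !linear0.
by rewrite tensDl tensDr !linearD IH /= tassoc_tens !cycle3_tens.
Qed.

Lemma tassoc_tmap_tswap_comp x :
  tassoc (tmap idfun (@tswap K U U \o f) x) =
  cycle3 (cycle3 (swap12 (tassoc (tmap idfun f x)))).
Proof.
apply: (tensor_ext (f := @tassoc K U U U \o tmap idfun (@tswap K U U \o f))
  (g := @cycle3 U \o (@cycle3 U \o (@swap12 U \o (@tassoc K U U U \o tmap idfun f))))) => u v.
rewrite /= !tmap_tens /=; move: (f v).
apply: (tensor_ext (f := @tassoc K U U U \o (tens u \o @tswap K U U))
  (g := @cycle3 U \o (@cycle3 U \o (@swap12 U \o (@tassoc K U U U \o tens u))))).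
by move=> x1 x2; rewrite /= tswap_tens !tassoc_tens swap12_tens !cycle3_tens.
Qed.

End TensorCube.

Section ZinbielIdentities.
Context {K : fieldType} {B : lmodType K} {nu : {linear B -> (B ⊗ B)%type}}.
Hypothesis znu : zinbiel nu.

Lemma zinbielE b : tassoc (tmap idfun nu (nu b)) =
  tmap nu idfun (nu b) + tmap (@tswap K B B \o nu) idfun (nu b).
Proof. by rewrite znu tmap_tswap_comp. Qed.

Lemma zinbiel_swap12 b :
  swap12 (tassoc (tmap idfun nu (nu b))) = tassoc (tmap idfun nu (nu b)).
Proof. by rewrite zinbielE tmap_tswap_comp linearD /= swap12K addrC. Qed.

Lemma zinbiel_middle b : tmap nu idfun (tswap (nu b)) =
  tassoc (tmap idfun (@tswap K B B \o nu) (nu b)).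
Proof. by rewrite tmap_tswap tassoc_tmap_tswap_comp zinbiel_swap12. Qed.

Lemma zinbiel_swap b :
  tmap (@tswap K B B \o nu) idfun (tswap (nu b)) =
  tassoc (tmap idfun nu (tswap (nu b))) +
  tassoc (tmap idfun (@tswap K B B \o nu) (tswap (nu b))).
Proof.
rewrite tmap_tswap_comp tmap_tswap cycle3_swap12 zinbiel_swap12 zinbielE.
by rewrite linearD !tassoc_tmap_tswap.
Qed.

End ZinbielIdentities.

Section CoassociatorOfDelta.
Context {K : fieldType}.

Lemma finite_fsum_bullet3 (D1 D2 D3 B : lmodType K)
    (F1 F2 F3 F4 : int -> (D1 ⊗ D2 ⊗ D3)%type) (y1 y2 y3 y4 : (B ⊗ B ⊗ B)%type)
    (G : int -> (D1 ⊗ B ⊗ (D2 ⊗ B) ⊗ (D3 ⊗ B))%type) :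
  finite_set [set n | F1 n != 0] -> finite_set [set n | F2 n != 0] ->
  finite_set [set n | F3 n != 0] -> finite_set [set n | F4 n != 0] ->
  (forall n, G n = (bullet3 (F1 n) y1 + bullet3 (F2 n) y2) +
                   (bullet3 (F3 n) y3 + bullet3 (F4 n) y4)) ->
  finite_set [set n | G n != 0] /\
  \sum_(n \in [set: int]) G n =
  (bullet3 (\sum_(n \in [set: int]) F1 n) y1 +
   bullet3 (\sum_(n \in [set: int]) F2 n) y2) +
  (bullet3 (\sum_(n \in [set: int]) F3 n) y3 +
   bullet3 (\sum_(n \in [set: int]) F4 n) y4).
Proof.
move=> f1 f2 f3 f4 /funext ->.
have fb (F : int -> (D1 ⊗ D2 ⊗ D3)%type) (y : (B ⊗ B ⊗ B)%type)
    (fF : finite_set [set n : int | F n != 0]) :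
    finite_set [set n : int | bullet3 (F n) y != 0].
  exact: (finite_support_raddf (@bullet3l K D1 D2 D3 B B B y) fF).
have sb (F : int -> (D1 ⊗ D2 ⊗ D3)%type) (y : (B ⊗ B ⊗ B)%type)
    (fF : finite_set [set n : int | F n != 0]) :
    \sum_(n \in [set: int]) bullet3 (F n) y = bullet3 (\sum_(n \in [set: int]) F n) y.
  exact: esym (raddf_fsum (@bullet3l K D1 D2 D3 B B B y) fF).
have fb12 := finite_supportD (fb _ y1 f1) (fb _ y2 f2).
have fb34 := finite_supportD (fb _ y3 f3) (fb _ y4 f4).
split; first exact: finite_supportD.
apply: etrans (fsumD fb12 fb34) _.
congr (_ + _).
  by apply: etrans (fsumD (fb _ y1 f1) (fb _ y2 f2)) _; congr (_ + _); exact: sb.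
by apply: etrans (fsumD (fb _ y3 f3) (fb _ y4 f4)) _; congr (_ + _); exact: sb.
Qed.

Lemma coassociative_tensors (D : gradedSpace K) (B : lmodType K)
    (T : {linear gtensor D B -> (gtensor D B ⊗^ gtensor D B)%type}) :
  (forall d b, [/\ cleft_defined T (T (tens d b : gtensor D B)),
    cright_defined T (T (tens d b : gtensor D B)) &
    cleft T (T (tens d b : gtensor D B)) = cright T (T (tens d b : gtensor D B))]) ->
  completed_coassociative T.
Proof.
move=> Tdb.
have lD a a' p q r n : cleft_term T (T (a + a')) p q r n =
    cleft_term T (T a) p q r n + cleft_term T (T a') p q r n.
  by rewrite /cleft_term linearD; exact: (linearD (tmap _ _)).
have rD a a' p q r n : cright_term T (T (a + a')) p q r n =
    cright_term T (T a) p q r n + cright_term T (T a') p q r n.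
  by rewrite /cright_term linearD; exact: (linearD (@tassoc K _ _ _ \o tmap _ _)).
have l0 p q r n : cleft_term T (T 0) p q r n = 0.
  by rewrite /cleft_term linear0; exact: (linear0 (tmap _ _)).
have r0 p q r n : cright_term T (T 0) p q r n = 0.
  by rewrite /cright_term linear0; exact: (linear0 (@tassoc K _ _ _ \o tmap _ _)).
apply: tens_ind => [|d b x [lx rx lrx]].
  split=> [p q r|p q r|].
  - by under eq_set do rewrite l0; exact: finite_support0.
  - by under eq_set do rewrite r0; exact: finite_support0.
  - do 3 (apply: functional_extensionality_dep => ?).
    by rewrite /cleft /cright !fsbig1 // => n _; [exact: r0 | exact: l0].
have [lt rt lrt] := Tdb d b.
split=> [p q r|p q r|].
- by under eq_set do rewrite lD; exact: finite_supportD (lt p q r) (lx p q r).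
- by under eq_set do rewrite rD; exact: finite_supportD (rt p q r) (rx p q r).
- apply: functional_extensionality_dep => p; apply: functional_extensionality_dep => q.
  apply: functional_extensionality_dep => r; rewrite /cleft /cright.
  under eq_fsbigr do rewrite lD; under [RHS]eq_fsbigr do rewrite rD.
  apply: etrans (fsumD (lt p q r) (lx p q r)) (etrans _ (esym (fsumD (rt p q r) (rx p q r)))).
  congr (_ + _).
  + exact: (congr1 (fun t => t p q r) lrt).
  + exact: (congr1 (fun t => t p q r) lrx).
Qed.

Context {D : gradedSpace K} {B : lmodType K}.
Variables (td tv : {linear D -> (D ⊗^ D)%type}) (nu : {linear B -> (B ⊗ B)%type}).
Hypothesis dD : completed_diassociative td tv.
Let T := Delta td tv nu.

Lemma cleft_Delta d b p q r :
  finite_set [set n | cleft_term T (T (tens d b)) p q r n != 0] /\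
  cleft T (T (tens d b)) p q r =
  (bullet3 (cleft tv (tv d) p q r)
     (tmap nu idfun (nu b) + tmap (@tswap K B B \o nu) idfun (nu b)) +
   bullet3 (cleft tv (td d) p q r) (tmap nu idfun (tswap (nu b)))) +
  bullet3 (cleft td (td d) p q r) (tmap (@tswap K B B \o nu) idfun (tswap (nu b)))
  :> (gcomp D p ⊗ B ⊗ (gcomp D q ⊗ B) ⊗ (gcomp D r ⊗ B))%type.
Proof.
have [/(_ d) [ld _ _] /(_ d) [lv _ _] /(_ d) [[lvd _ ldv _] [_ _ e]]] := dD.
have [fin sumE] := finite_fsum_bullet3 (lv p q r) (ldv p q r) (lvd p q r) (ld p q r)
  (cleft_term_Delta td tv nu d b p q r).
split=> //; apply: etrans sumE _; rewrite -/(cleft tv (tv d) p q r) -/(cleft td (tv d) p q r).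
by rewrite e linearD /= !addrA.
Qed.

Lemma cright_Delta d b p q r :
  finite_set [set n | cright_term T (T (tens d b)) p q r n != 0] /\
  cright T (T (tens d b)) p q r =
  (bullet3 (cleft tv (tv d) p q r) (tassoc (tmap idfun nu (nu b))) +
   bullet3 (cleft tv (td d) p q r)
     (tassoc (tmap idfun (@tswap K B B \o nu) (nu b)))) +
  bullet3 (cleft td (td d) p q r) (tassoc (tmap idfun nu (tswap (nu b))) +
     tassoc (tmap idfun (@tswap K B B \o nu) (tswap (nu b))))
  :> (gcomp D p ⊗ B ⊗ (gcomp D q ⊗ B) ⊗ (gcomp D r ⊗ B))%type.
Proof.
have [/(_ d) [_ rd ed] /(_ d) [_ rv ev] /(_ d) [[_ rvd _ rdv] [e1 e2 _]]] := dD.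
have [fin sumE] := finite_fsum_bullet3 (rv p q r) (rdv p q r) (rvd p q r) (rd p q r)
  (cright_term_Delta td tv nu d b p q r).
split=> //; apply: etrans sumE _; rewrite -/(cright tv (tv d) p q r) -/(cright td (tv d) p q r).
rewrite -/(cright tv (td d) p q r) -/(cright td (td d) p q r).
by rewrite -ev -e2 -e1 -ed linearD.
Qed.

Lemma Delta_coassociative : zinbiel nu -> completed_coassociative T.
Proof.
move=> znu; apply: coassociative_tensors => d b; split=> [p q r|p q r|].
- exact: (cleft_Delta d b p q r).1.
- exact: (cright_Delta d b p q r).1.
apply: functional_extensionality_dep => p; apply: functional_extensionality_dep => q.
apply: functional_extensionality_dep => r.
apply: etrans (cleft_Delta d b p q r).2 (etrans _ (esym (cright_Delta d b p q r).2)).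
by rewrite -zinbielE // zinbiel_middle // zinbiel_swap.
Qed.

End CoassociatorOfDelta.

Section Evaluation.
Context {K : fieldType}.

Definition ceval (U V : gradedSpace K) p q (x : (U ⊗^ V)%type) := x p q.

HB.instance Definition _ (U V : gradedSpace K) p q := GRing.isLinear.Build K
  (U ⊗^ V)%type (gcomp U p ⊗ gcomp V q)%type *:%R (@ceval U V p q)
  (fun _ _ _ => erefl).

Definition tensl (U V : lmodType K) (v : V) := (@tens K U V)^~ v.

HB.instance Definition _ (U V : lmodType K) (v : V) := GRing.isLinear.Build K U
  (U ⊗ V)%type *:%R (@tensl U V v) ((tens_bilin U V).1 v).

Lemma tensBl (U V : lmodType K) (u u' : U) (v : V) :
  tens (u - u') v = tens u v - tens u' v.
Proof. exact: (linearB (tensl v)). Qed.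

Lemma tensBr (U V : lmodType K) (u : U) (v v' : V) :
  tens u (v - v') = tens u v - tens u v'.
Proof. exact: linearB. Qed.

End Evaluation.

Section Contraction.
Context {K : fieldType}.

Lemma bilin_scale (U B : lmodType K) (f : {linear U -> K^o}) :
  bilin (fun (u : U) (b : B) => f u *: b).
Proof.
split=> [b|u] a x y; first by rewrite linearP scalerDl scalerA.
by rewrite scalerDr !scalerA mulrC.
Qed.

Definition contract (U : lmodType K) (f : {linear U -> K^o}) (B : lmodType K) :
  (U ⊗ B)%type -> B := tlift (fun u b => f u *: b).
Arguments contract [U] f B x.

HB.instance Definition _ (U : lmodType K) (f : {linear U -> K^o}) (B : lmodType K) :=
  GRing.isLinear.Build K (U ⊗ B)%type B *:%R (contract f B) (tlift_linear (bilin_scale B f)).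

Lemma contract_tens (U : lmodType K) (f : {linear U -> K^o}) (B : lmodType K) u b :
  contract f B (tens u b) = f u *: b.
Proof. exact: tlift_tens (bilin_scale B f) _ _. Qed.

Lemma contract_bullet (U1 U2 B : lmodType K) (f1 : {linear U1 -> K^o})
    (f2 : {linear U2 -> K^o}) u1 u2 (y : (B ⊗ B)%type) :
  tmap (contract f1 B) (contract f2 B) (bullet (tens u1 u2) y) = (f1 u1 * f2 u2 : K) *: y.
Proof.
move: y; apply: tens_ind => [|b b' y IH].
  by rewrite (bilin0r _ (@bilin_bullet K _ _ _ _)) linear0 scaler0.
rewrite (bilin_addr _ (@bilin_bullet K _ _ _ _)) linearD /= IH scalerDr; congr (_ + _).
by rewrite bullet_tens tmap_tens /= !contract_tens tensZl tensZr scalerA.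
Qed.

Lemma contract_bullet3 (U1 U2 U3 B : lmodType K) (f1 : {linear U1 -> K^o})
    (f2 : {linear U2 -> K^o}) (f3 : {linear U3 -> K^o}) u1 u2 u3
    (y : (B ⊗ B ⊗ B)%type) :
  tmap (tmap (contract f1 B) (contract f2 B)) (contract f3 B)
    (bullet3 (tens (tens u1 u2) u3) y) = (f1 u1 * f2 u2 * f3 u3 : K) *: y.
Proof.
move: y; apply: tens_ind => [|x b y IH]; first by rewrite !linear0.
rewrite !linearD /= IH; congr (_ + _).
by rewrite bullet3_tens tmap_tens /= contract_bullet contract_tens tensZl tensZr scalerA.
Qed.

(* Contract with psi ⊗ psi ⊗ phi, which kills [w ⊗ e ⊗ w] and [e ⊗ w ⊗ w]. *)
Lemma bullet3_inj (U B : lmodType K) (psi phi : {linear U -> K^o}) (w e : U)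
    (x y z x' y' z' : (B ⊗ B ⊗ B)%type) :
  psi w = 1 -> phi w = 0 -> phi e = 1 ->
  bullet3 (tens (tens w w) e) x + bullet3 (tens (tens w e) w) y +
    bullet3 (tens (tens e w) w) z =
  bullet3 (tens (tens w w) e) x' + bullet3 (tens (tens w e) w) y' +
    bullet3 (tens (tens e w) w) z' ->
  x = x'.
Proof.
move=> psiw phiw phie.
pose g : {linear (U ⊗ B ⊗ (U ⊗ B) ⊗ (U ⊗ B))%type -> (B ⊗ B ⊗ B)%type} :=
  tmap (tmap (contract psi B) (contract psi B)) (contract phi B).
have gE u1 u2 u3 t : g (bullet3 (tens (tens u1 u2) u3) t) =
    (psi u1 * psi u2 * phi u3 : K) *: t by exact: contract_bullet3.
have gx (x1 x2 x3 : (B ⊗ B ⊗ B)%type) : g (bullet3 (tens (tens w w) e) x1 +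
    bullet3 (tens (tens w e) w) x2 + bullet3 (tens (tens e w) w) x3) = x1.
  apply: etrans (linearD g _ _) _.
  apply: etrans (congr2 +%R (linearD g _ _) (gE _ _ _ _)) _.
  apply: etrans (congr1 (+%R^~ _) (congr2 +%R (gE _ _ _ _) (gE _ _ _ _))) _.
  by rewrite psiw phiw phie !mulr0 !mulr1 !scale0r scale1r !addr0.
by move=> /(congr1 g); rewrite !gx.
Qed.

End Contraction.
Arguments contract [K U] f B x.

Section LaurentCoalgebra.
Context {K : fieldType}.
Local Notation C := (@Dcomp K).
Local Notation L := (gradedD K).

(* In every degree, e1 and e2 are the coordinates of t^(i-1) ∂_1 and t^i ∂_2;
   both θ's then become degree-independent: θ_⊣ = (- ⊗ w), θ_⊢ = (w ⊗ -). *)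
Let e1 : C := (1, 0).
Let e2 : C := (0, 1).
Let w : C := e1 - e2.

Lemma Dproj_dx n i : gproj L n (dx i) = (i == n - 1)%:R *: e1.
Proof.
by rewrite /= /Dproj /dx /= mcoeffU mcoeff0; congr pair; rewrite ?scaler0 // [RHS]mulr1.
Qed.

Lemma Dproj_dy n i : gproj L n (dy i) = (i == n)%:R *: e2.
Proof.
by rewrite /= /Dproj /dy /= mcoeffU mcoeff0; congr pair; rewrite ?scaler0 // [RHS]mulr1.
Qed.

Lemma Dproj_Dinj n i (c : C) : gproj L n (ginj L i c) = (i == n)%:R *: c.
Proof.
have [<-|ne] := eqVneq i n; first by rewrite gproj_inj scale1r.
by rewrite gproj_inj0 // scale0r.
Qed.

Lemma sum_indicator (V : lmodType K) (F : int -> V) n0 :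
  \sum_(n \in [set: int]) (n == n0)%:R *: F n = F n0.
Proof.
rewrite (@fsum_single _ _ _ n0) ?eqxx ?scale1r // => n /negPf ->.
by rewrite scale0r.
Qed.

Lemma finite_indicator (V : lmodType K) (F : int -> V) n0 :
  finite_set [set n | (n == n0)%:R *: F n != 0].
Proof. by apply: (@finite_support_single _ _ _ n0) => n /negPf ->; rewrite scale0r. Qed.

Lemma laurent_ext (V : lmodType K) (f g : {linear L -> V}) :
  (forall i, f (dx i) = g (dx i)) -> (forall i, f (dy i) = g (dy i)) -> f =1 g.
Proof.
move=> fgx fgy d.
have fin : finite_set [set n | ginj L n (gproj L n d) != 0].
  apply: (sub_finite_set _ (gproj_fin d)) => n /=.
  by apply: contraNneq => ->; rewrite linear0.
rewrite (gsum d) (raddf_fsum f fin) (raddf_fsum g fin).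
apply: eq_fsbigr => n _; move: (gproj L n d) => c.
have E (h : {linear L -> V}) :
    h (ginj L n c) = c.1 *: h (dx (n - 1)) + c.2 *: h (dy n).
  by apply: etrans (linearD h _ _) _; congr (_ + _); exact: linearZ.
by apply: etrans (E f) (etrans _ (esym (E g))); rewrite fgx fgy.
Qed.

Lemma csum_monomials (u v u' v' : int -> L) (p q m m' : int) (c : bool)
    (t t' : (C ⊗ C)%type) :
  (forall j, tens (gproj L p (u j)) (gproj L q (v j)) =
     (j == m)%:R *: (c%:R *: t)) ->
  (forall j, tens (gproj L p (u' j)) (gproj L q (v' j)) =
     (j == m')%:R *: (c%:R *: t')) ->
  csum (fun j => ctens (u j) (v j) - ctens (u' j) (v' j)) p q = c%:R *: (t - t').
Proof.
move=> uv uv'.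
have E j : (ctens (u j) (v j) - ctens (u' j) (v' j)) p q =
    (j == m)%:R *: (c%:R *: t) + (j == m')%:R *: (- (c%:R *: t')).
  by rewrite scalerN -uv -uv'.
rewrite /csum; under eq_fsbigr do rewrite E.
apply: etrans (fsumD (finite_indicator (fun=> c%:R *: t) m)
  (finite_indicator (fun=> - (c%:R *: t')) m')) _.
rewrite scalerBr; congr (_ + _).
- exact: (sum_indicator (fun=> c%:R *: t)).
- exact: (sum_indicator (fun=> - (c%:R *: t'))).
Qed.

Lemma theta_dashvE (d : L) p q :
  theta_dashv K d p q = tens (gproj L (p + q - 1) d) w.
Proof.
apply: (laurent_ext (f := ceval p q \o theta_dashv K)
  (g := tensl w \o gproj L (p + q - 1))) => i /=; rewrite /ceval /tensl.
- rewrite theta_dashv_dx Dproj_dx tensZl tensBr.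
  apply: (@csum_monomials _ _ _ _ _ _ (1 - p) (1 - p)) => j;
    rewrite !(Dproj_dx, Dproj_dy) tensZl tensZr !scalerA -!natrM !mulnb;
    congr ((nat_of_bool _)%:R *: _); lia.
- rewrite theta_dashv_dy Dproj_dy tensZl tensBr.
  apply: (@csum_monomials _ _ _ _ _ _ (- p) (- p)) => j;
    rewrite !(Dproj_dx, Dproj_dy) tensZl tensZr !scalerA -!natrM !mulnb;
    congr ((nat_of_bool _)%:R *: _); lia.
Qed.

Lemma theta_vdashE (d : L) p q :
  theta_vdash K d p q = tens w (gproj L (p + q - 1) d).
Proof.
apply: (laurent_ext (f := ceval p q \o theta_vdash K)
  (g := tens w \o gproj L (p + q - 1))) => i /=; rewrite /ceval.
- rewrite theta_vdash_dx Dproj_dx tensZr tensBl.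
  apply: (@csum_monomials _ _ _ _ _ _ (1 - p) (- p)) => j;
    rewrite !(Dproj_dx, Dproj_dy) tensZl tensZr !scalerA -!natrM !mulnb;
    congr ((nat_of_bool _)%:R *: _); lia.
- rewrite theta_vdash_dy Dproj_dy tensZr tensBl.
  apply: (@csum_monomials _ _ _ _ _ _ (1 - p) (- p)) => j;
    rewrite !(Dproj_dx, Dproj_dy) tensZl tensZr !scalerA -!natrM !mulnb;
    congr ((nat_of_bool _)%:R *: _); lia.
Qed.

Lemma ccomp_dashv n p q (c : C) : ccomp (theta_dashv K) (n := n) p q c =
  (n == p + q - 1)%:R *: tens c w.
Proof.
by apply: etrans (theta_dashvE (ginj L n c) p q) _; rewrite Dproj_Dinj tensZl.
Qed.

Lemma ccomp_vdash n p q (c : C) : ccomp (theta_vdash K) (n := n) p q c =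
  (n == p + q - 1)%:R *: tens w c.
Proof.
by apply: etrans (theta_vdashE (ginj L n c) p q) _; rewrite Dproj_Dinj tensZr.
Qed.

Lemma cleft_term_dashv (x : (L ⊗^ L)%type) n p q r (c c' : C) :
  x n r = tens c c' ->
  cleft_term (theta_dashv K) x p q r n = (n == p + q - 1)%:R *: tens (tens c w) c'.
Proof.
move=> xE; rewrite /cleft_term xE; apply: etrans (tmap_tens _ _ _ _) _.
by apply: etrans (congr1 (tensl c') (ccomp_dashv n p q c)) _; rewrite linearZ.
Qed.

Lemma cleft_term_vdash (x : (L ⊗^ L)%type) n p q r (c c' : C) :
  x n r = tens c c' ->
  cleft_term (theta_vdash K) x p q r n = (n == p + q - 1)%:R *: tens (tens w c) c'.
Proof.
move=> xE; rewrite /cleft_term xE; apply: etrans (tmap_tens _ _ _ _) _.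
by apply: etrans (congr1 (tensl c') (ccomp_vdash n p q c)) _; rewrite linearZ.
Qed.

Lemma cright_term_dashv (x : (L ⊗^ L)%type) n p q r (c c' : C) :
  x p n = tens c c' ->
  cright_term (theta_dashv K) x p q r n = (n == q + r - 1)%:R *: tens (tens c c') w.
Proof.
move=> xE; rewrite /cright_term xE.
apply: etrans (congr1 (@tassoc K C C C) (tmap_tens _ _ _ _)) _.
apply: etrans (congr1 (@tassoc K C C C \o tens c) (ccomp_dashv n q r c')) _.
by rewrite linearZ /= tassoc_tens.
Qed.

Lemma cright_term_vdash (x : (L ⊗^ L)%type) n p q r (c c' : C) :
  x p n = tens c c' ->
  cright_term (theta_vdash K) x p q r n = (n == q + r - 1)%:R *: tens (tens c w) c'.
Proof.
move=> xE; rewrite /cright_term xE.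
apply: etrans (congr1 (@tassoc K C C C) (tmap_tens _ _ _ _)) _.
apply: etrans (congr1 (@tassoc K C C C \o tens c) (ccomp_vdash n q r c')) _.
by rewrite linearZ /= tassoc_tens.
Qed.

Lemma indicator_family (V : lmodType K) (F G : int -> V) m :
  (forall n, F n = (n == m)%:R *: G n) ->
  finite_set [set n | F n != 0] /\ \sum_(n \in [set: int]) F n = G m.
Proof.
by move=> /funext ->; split; [exact: finite_indicator|rewrite sum_indicator].
Qed.

Let cleft_dashv_dashv d p q r := indicator_family (fun n =>
  cleft_term_dashv p q (theta_dashvE d n r)).
Let cleft_dashv_vdash d p q r := indicator_family (fun n =>
  cleft_term_dashv p q (theta_vdashE d n r)).
Let cleft_vdash_dashv d p q r := indicator_family (fun n =>
  cleft_term_vdash p q (theta_dashvE d n r)).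
Let cleft_vdash_vdash d p q r := indicator_family (fun n =>
  cleft_term_vdash p q (theta_vdashE d n r)).
Let cright_dashv_dashv d p q r := indicator_family (fun n =>
  cright_term_dashv q r (theta_dashvE d p n)).
Let cright_dashv_vdash d p q r := indicator_family (fun n =>
  cright_term_dashv q r (theta_vdashE d p n)).
Let cright_vdash_dashv d p q r := indicator_family (fun n =>
  cright_term_vdash q r (theta_dashvE d p n)).
Let cright_vdash_vdash d p q r := indicator_family (fun n =>
  cright_term_vdash q r (theta_vdashE d p n)).

Let ctensor3_eq (x y : ctensor3 L L L) : (forall p q r, x p q r = y p q r) -> x = y.
Proof. by move=> xy; do 3 (apply: functional_extensionality_dep => ?). Qed.

Let degE (p q r : int) : p + q - 1 + r - 1 = p + (q + r - 1) - 1.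
Proof. by lia. Qed.

Lemma laurent_diassociative :
  completed_diassociative (theta_dashv K) (theta_vdash K).
Proof.
split=> [d|d|d].
- split=> [p q r|p q r|].
  + exact: (cleft_dashv_dashv d p q r).1.
  + exact: (cright_dashv_dashv d p q r).1.
  apply: ctensor3_eq => p q r; apply: etrans (cleft_dashv_dashv d p q r).2 _.
  by apply: etrans (esym (cright_dashv_dashv d p q r).2); rewrite degE.
- split=> [p q r|p q r|].
  + exact: (cleft_vdash_vdash d p q r).1.
  + exact: (cright_vdash_vdash d p q r).1.
  apply: ctensor3_eq => p q r; apply: etrans (cleft_vdash_vdash d p q r).2 _.
  by apply: etrans (esym (cright_vdash_vdash d p q r).2); rewrite degE.
split; first split=> p q r.
- exact: (cleft_vdash_dashv d p q r).1.
- exact: (cright_vdash_dashv d p q r).1.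
- exact: (cleft_dashv_vdash d p q r).1.
- exact: (cright_dashv_vdash d p q r).1.
split; apply: ctensor3_eq => p q r.
- apply: etrans (cleft_dashv_dashv d p q r).2 _.
  by apply: etrans (esym (cright_vdash_dashv d p q r).2); rewrite degE.
- apply: etrans (cleft_vdash_dashv d p q r).2 _.
  by apply: etrans (esym (cright_dashv_vdash d p q r).2); rewrite degE.
- apply: etrans (cleft_dashv_vdash d p q r).2 _.
  exact: esym (cleft_vdash_vdash d p q r).2.
Qed.

Lemma zinbiel_of_coassociative (B : lmodType K) (nu : {linear B -> (B ⊗ B)%type}) :
  completed_coassociative (Delta (theta_dashv K) (theta_vdash K) nu) -> zinbiel nu.
Proof.
(* -2 is the degree of the elements contributing to the tridegree (0, 0, 0). *)
pose d : L := ginj L (0 + 0 - 1 + 0 - 1) e1.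
have gd : gproj L (0 + 0 - 1 + 0 - 1) d = e1 by exact: gproj_inj.
move=> coas b; have [_ _ /(congr1 (fun t => t 0 0 0))] := coas (tens d b).
have dia := laurent_diassociative.
move=> eqT; have := etrans (esym (cleft_Delta nu dia d b 0 0 0).2)
  (etrans eqT (cright_Delta nu dia d b 0 0 0).2).
have -> : cleft (theta_vdash K) (theta_vdash K d) 0 0 0 = tens (tens w w) e1.
  by apply: etrans (cleft_vdash_vdash d 0 0 0).2 _; rewrite gd.
have -> : cleft (theta_vdash K) (theta_dashv K d) 0 0 0 = tens (tens w e1) w.
  by apply: etrans (cleft_vdash_dashv d 0 0 0).2 _; rewrite gd.
have -> : cleft (theta_dashv K) (theta_dashv K d) 0 0 0 = tens (tens e1 w) w.
  by apply: etrans (cleft_dashv_dashv d 0 0 0).2 _; rewrite gd.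
pose psi : {linear C -> K^o} := fst.
pose phi : {linear C -> K^o} := fst \+ snd.
have psiw : psi w = 1 by rewrite /= subr0.
have phiw : phi w = 0 by rewrite /= subr0 sub0r subrr.
have phie : phi e1 = 1 by rewrite /= addr0.
by move=> /(bullet3_inj psiw phiw phie); rewrite tmap_tswap_comp => <-.
Qed.

End LaurentCoalgebra.

Theorem proposition4p6 (K : fieldType) (charK : [pchar K] =i pred0) :
  (forall (B : vectType K) (nu : {linear B -> (B ⊗ B)%type})
      (D : gradedSpace K) (td tv : {linear D -> (D ⊗^ D)%type}),
    zinbiel nu -> completed_diassociative td tv ->
    completed_coassociative (Delta td tv nu))
  /\
  (completed_diassociative (theta_dashv K) (theta_vdash K) /\
   forall (B : vectType K) (nu : {linear B -> (B ⊗ B)%type}),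
    completed_coassociative (Delta (theta_dashv K) (theta_vdash K) nu) <->
    zinbiel nu).
Proof.
split=> [B nu D td tv znu dD|]; first exact: Delta_coassociative.
split=> [|B nu]; first exact: laurent_diassociative.
split=> [|znu]; first exact: zinbiel_of_coassociative.
exact/Delta_coassociative/znu/laurent_diassociative.
Qed.
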